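(* Let $\mathbb{C}$ be a category with finite products and let $X$ be any object of $\mathbb{C}$ with co-disjoint products. Then the following are equivalent: (i) $X$ is projection-coextensive. (ii) The pushout of any two product projections of $X$ exists and consists of product projections (i.e. the two morphisms into the pushout object are product projections), and $\mathrm{Proj}(X)$ is a Boolean lattice.
   Context: A product projection of $X$ is a morphism $X\to A$ that is one of the two legs of some binary product diagram $A\leftarrow X\to A'$; the two legs of a binary product diagram are called complementary. $X$ has co-disjoint products if every product projection of $X$ is an epimorphism and the pushout of any two complementary product projections of $X$ is terminal. For a class $\mathcal{M}$ of morphisms, an $\mathcal{M}$-pushout is a pushout square whose two morphisms into the pushout object belong to $\mathcal{M}$. An object $X$ is $\mathcal{M}$-coextensive if every morphism in $\mathcal{M}$ with domain $X$ admits an $\mathcal{M}$-pushout along every product projection of $X$, and for every commutative diagram consisting of a product diagram $A_1\leftarrow X\to A_2$ (top row), a bottom row $B_1\leftarrow Y\to B_2$, and vertical morphisms $A_1\to B_1$, $X\to Y$, $A_2\to B_2$ all in $\mathcal{M}$, the bottom row is a product diagram if and only if both squares are $\mathcal{M}$-pushouts. $X$ is projection-coextensive if it is $\mathcal{M}$-coextensive with $\mathcal{M}$ the class of all product projections in $\mathbb{C}$. When all product projections of $X$ are epimorphisms, the full subcategory of the coslice category $X\downarrow\mathbb{C}$ on the product projections of $X$ is a preorder; $\mathrm{Proj}(X)$ denotes its posetal reflection. Thus elements are classes $[p]$ of product projections $p$ of $X$, and $[p]\leqslant[q]$ if and only if $q$ factors through $p$. *)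

(* Defs.v *)
From HB Require Import structures.
From mathcomp Require Import all_boot all_order.
From mathcomp Require Import boolp.

Set Implicit Arguments.
Unset Strict Implicit.
Unset Printing Implicit Defensive.

Import Order.TTheory.

Declare Scope cat_scope.
Delimit Scope cat_scope with cat.

Record category := Category {
  obj :> Type;
  hom : obj -> obj -> Type;
  idm : forall A : obj, hom A A;
  comp : forall A B C : obj, hom B C -> hom A B -> hom A C;
  comp1m : forall (A B : obj) (f : hom A B), comp (idm B) f = f;
  compm1 : forall (A B : obj) (f : hom A B), comp f (idm A) = f;
  compA : forall (A B C D : obj) (h : hom C D) (g : hom B C) (f : hom A B),
    comp h (comp g f) = comp (comp h g) f
}.

Arguments hom {c} A B.
Arguments idm {c} A.
Arguments comp {c A B C} g f.

Notation "g ∘ f" := (comp g f) (at level 40, left associativity) : cat_scope.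
Local Open Scope cat_scope.

Definition epi (C : category) (A B : C) (f : hom A B) : Prop :=
  forall (Z : C) (g h : hom B Z), g ∘ f = h ∘ f -> g = h.

Definition is_terminal (C : category) (T : C) : Prop :=
  forall Y : C, exists! t : hom Y T, True.

Definition has_finite_products (C : category) : Prop :=
  forall (I : finType) (A : I -> C),
  exists (P : C) (pi : forall i, hom P (A i)),
  forall (Y : C) (f : forall i, hom Y (A i)),
  exists! h : hom Y P, forall i, pi i ∘ h = f i.

Definition is_product (C : category) (X A1 A2 : C)
    (p1 : hom X A1) (p2 : hom X A2) : Prop :=
  forall (Y : C) (f1 : hom Y A1) (f2 : hom Y A2),
  exists! h : hom Y X, p1 ∘ h = f1 /\ p2 ∘ h = f2.

(* The square with sides f, g : X -> A, B and u, v : A, B -> P. *)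
Definition is_pushout (C : category) (X A B P : C)
    (f : hom X A) (g : hom X B) (u : hom A P) (v : hom B P) : Prop :=
  u ∘ f = v ∘ g /\
  forall (Z : C) (a : hom A Z) (b : hom B Z), a ∘ f = b ∘ g ->
  exists! h : hom P Z, h ∘ u = a /\ h ∘ v = b.

Definition product_projection (C : category) (X A : C) (p : hom X A) : Prop :=
  exists (A' : C) (p' : hom X A'), is_product p p' \/ is_product p' p.

Definition codisjoint_products (C : category) (X : C) : Prop :=
  (forall (A : C) (p : hom X A), product_projection p -> epi p) /\
  (forall (A1 A2 : C) (p1 : hom X A1) (p2 : hom X A2), is_product p1 p2 ->
   exists (P : C) (u1 : hom A1 P) (u2 : hom A2 P),
     is_pushout p1 p2 u1 u2 /\ is_terminal P).

Definition morphism_class (C : category) := forall A B : C, hom A B -> Prop.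

Definition is_Mpushout (C : category) (M : morphism_class C) (X A B P : C)
    (f : hom X A) (g : hom X B) (u : hom A P) (v : hom B P) : Prop :=
  [/\ is_pushout f g u v, M A P u & M B P v].

Definition Mcoextensive (C : category) (M : morphism_class C) (X : C) : Prop :=
  (forall (Y A : C) (f : hom X Y) (p : hom X A),
     M X Y f -> product_projection p ->
     exists (P : C) (u : hom Y P) (v : hom A P), is_Mpushout M f p u v) /\
  (forall (A1 A2 Y B1 B2 : C) (p1 : hom X A1) (p2 : hom X A2)
     (q1 : hom Y B1) (q2 : hom Y B2)
     (f1 : hom A1 B1) (f : hom X Y) (f2 : hom A2 B2),
     is_product p1 p2 -> M A1 B1 f1 -> M X Y f -> M A2 B2 f2 ->
     f1 ∘ p1 = q1 ∘ f -> f2 ∘ p2 = q2 ∘ f ->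
     (is_product q1 q2 <->
      is_Mpushout M p1 f f1 q1 /\ is_Mpushout M p2 f f2 q2)).

Definition projection_coextensive (C : category) (X : C) : Prop :=
  Mcoextensive (@product_projection C) X.

(* The objects of the full subcategory of the coslice X | C. *)
Record proj_of (C : category) (X : C) := ProjOf {
  proj_cod : C;
  proj_mor : hom X proj_cod;
  proj_morP : product_projection proj_mor
}.

HB.instance Definition _ (C : category) (X : C) := gen_eqMixin (proj_of X).
HB.instance Definition _ (C : category) (X : C) := gen_choiceMixin (proj_of X).

Section ProjPoset.
Variables (C : category) (X : C).
Implicit Types p q : proj_of X.

(* This is a preorder whether or not the projections are epimorphisms; when
   they are, the mediating h is unique and the full subcategory is thin. *)
Definition proj_le p q : bool :=
  `[< exists h : hom (proj_cod p) (proj_cod q), proj_mor q = h ∘ proj_mor p >].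

Lemma proj_le_refl : reflexive proj_le.
Proof. by move=> p; apply/asboolP; exists (idm _); rewrite comp1m. Qed.

Lemma proj_le_trans : transitive proj_le.
Proof.
move=> q p r /asboolP[h hE] /asboolP[k kE]; apply/asboolP.
by exists (k ∘ h); rewrite kE hE compA.
Qed.

Definition proj_equiv p q : bool := proj_le p q && proj_le q p.

Lemma proj_equiv_is_equiv : equiv_class_of proj_equiv.
Proof.
split=> [p|p q|q p r]; rewrite /proj_equiv ?proj_le_refl //.
  by rewrite andbC.
move=> /andP[pq qp] /andP[qr rq].
by rewrite (proj_le_trans pq qr) (proj_le_trans rq qp).
Qed.

Canonical proj_equiv_rel := EquivRelPack proj_equiv_is_equiv.

End ProjPoset.

Definition Proj (C : category) (X : C) := {eq_quot (proj_equiv_rel X)}%qT.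

HB.instance Definition _ (C : category) (X : C) := Choice.on (Proj X).

Section ProjPosetOrder.
Variables (C : category) (X : C).

Definition proj_class (p : proj_of X) : Proj X := \pi_(Proj X)%qT p.
Definition Proj_le (a b : Proj X) : bool := proj_le (repr a) (repr b).

Lemma repr_proj_class (p : proj_of X) : proj_equiv (repr (proj_class p)) p.
Proof. by apply/eqmodP; rewrite reprK. Qed.

Lemma Proj_le_refl : reflexive Proj_le.
Proof. by move=> a; apply: proj_le_refl. Qed.

Lemma Proj_le_anti : antisymmetric Proj_le.
Proof.
by move=> a b ab; rewrite -[a]reprK -[b]reprK; apply/eqmodP.
Qed.

Lemma Proj_le_trans : transitive Proj_le.
Proof. by move=> b a c; apply: proj_le_trans. Qed.

End ProjPosetOrder.

HB.instance Definition _ (C : category) (X : C) :=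
  Order.Le_isPOrder.Build (Order.Disp tt tt) (Proj X)
    (@Proj_le_refl C X) (@Proj_le_anti C X) (@Proj_le_trans C X).

(* [p] <= [q] iff q factors through p. *)
Lemma le_proj_class (C : category) (X : C) (p q : proj_of X) :
  (proj_class p <= proj_class q)%O <->
  exists h : hom (proj_cod p) (proj_cod q), proj_mor q = h ∘ proj_mor p.
Proof.
have /andP[p1 p2] := repr_proj_class p; have /andP[q1 q2] := repr_proj_class q.
split=> [pq|/asboolP pq].
  exact/asboolP/(proj_le_trans p2)/(proj_le_trans pq).
exact: (proj_le_trans p1 (proj_le_trans pq q2)).
Qed.

(* The bundled type carries the Boolean operations as data, so being a Boolean
   lattice, as a property of a poset, is order isomorphism with such a type. *)
Definition is_boolean_lattice d (P : porderType d) : Prop :=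
  exists (d' : Order.disp_t) (L : ctbDistrLatticeType d') (f : P -> L),
  bijective f /\ {mono f : x y / (x <= y)%O}.

(* Main.v *)
(* In [Proj X], pushouts are joins, a product projection [X -> B1 * B2] is the
   meet of its two components, and complementary projections are complements:
   their meet is [idm X], and their join is terminal by co-disjointness.
   Coextensivity along complementary projections [p1, p2] therefore says that
   [z |-> (z v p1, z v p2)] is an isomorphism from [Proj X] to the product of
   the up-sets of [p1] and [p2], i.e. that every element is central, which
   makes the lattice Boolean.  Conversely, when [Proj X] is distributive,
   [f = (f v p1) ^ (f v p2)] turns two pushouts into a product; and if
   [f = a ^ b] with [p1 <= a] and [p2 <= b], then [a = f v p1], so a product
   yields two pushouts. *)
From HB Require Import structures.
Require Import Defs.
From mathcomp Require Import all_boot all_order.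
From mathcomp Require Import boolp.
(* Reclaims [compA], which ssrfun shadows. *)
Import Defs.

Set Implicit Arguments.
Unset Strict Implicit.
Unset Printing Implicit Defensive.

Import Order.TTheory.

Local Open Scope cat_scope.
Local Open Scope order_scope.

(** * Recognising and using Boolean lattices *)

Lemma boolean_lattice_of_operations d (P : porderType d)
    (mt jn : P -> P -> P) (cp : P -> P) (bt tp : P) :
  (forall x y z, (x <= mt y z) = (x <= y) && (x <= z)) ->
  (forall x y z, (jn x y <= z) = (x <= z) && (y <= z)) ->
  left_distributive mt jn ->
  (forall x, bt <= x) -> (forall x, x <= tp) ->
  (forall x, jn x (cp x) = tp) -> (forall x, mt x (cp x) = bt) ->
  is_boolean_lattice P.
Proof.
(* The [Build] notations do not unify an abstract [P] with its
   eta-expansion, so [P] is first made a constructor. *)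
case: P mt jn cp bt tp => T T_po mt jn cp bt tp.
move=> meetP joinP distr bt_le le_tp jnC mtC.
pose P : porderType d := Order.POrder.Pack T_po.
pose lat := Order.POrder_MeetJoin_isLattice.Build d P meetP joinP.
pose L1 : latticeType d := HB.pack T P lat.
pose dis := Order.Lattice_Meet_isDistrLattice.Build d L1 distr.
pose bot := Order.hasBottom.Build d P bt_le.
pose top := Order.hasTop.Build d P le_tp.
pose L2 : tbDistrLatticeType d := HB.pack T P L1 dis bot top.
pose com := Order.TBDistrLattice_hasComplement.Build d L2 jnC mtC.
pose L : ctbDistrLatticeType d := HB.pack T P L2 com.
by exists d, L, id; split=> //; exists id.
Qed.

(* Binary distributivity, phrased without naming meets and joins. *)
Lemma boolean_lattice_cover d (P : porderType d) (x y j a c : P) :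
  is_boolean_lattice P ->
  (forall w, x <= w -> y <= w -> j <= w) -> a <= j ->
  (forall w, w <= x -> w <= a -> w <= c) ->
  (forall w, w <= y -> w <= a -> w <= c) -> a <= c.
Proof.
case=> d' [L [f [[g fK gK] f_mono]]] j_lub aj xac yac.
have ac_of u : (forall w, w <= u -> w <= a -> w <= c) -> f u `&` f a <= f c.
  move=> uac; rewrite -[_ `&` _]gK f_mono; apply: uac.
    by rewrite -f_mono gK leIl.
  by rewrite -f_mono gK leIr.
have aU : f a <= f x `|` f y.
  rewrite -[_ `|` _]gK f_mono (le_trans aj) //; apply: j_lub.
    by rewrite -f_mono gK leUl.
  by rewrite -f_mono gK leUr.
(* As [f a] lies below [f x v f y], it is the join of its meets with [f x] and [f y]; [ac_of] bounds
   each of them by [f c]. *)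
by rewrite -f_mono -(meet_r aU) meetUl leUx !ac_of.
Qed.

(* The map [z |-> (z v x, z v cp x)] identifies [P] with the product of the
   up-sets of [x] and [cp x]; meets with [x] and distributivity over [x] are
   computed there. *)
Lemma boolean_lattice_of_central d (P : porderType d)
    (jn : P -> P -> P) (cp : P -> P) (bt tp : P) :
  (forall x y z, (jn x y <= z) = (x <= z) && (y <= z)) ->
  (forall x, bt <= x) -> (forall x, x <= tp) ->
  (forall x, jn x (cp x) = tp) ->
  (forall x z w, w <= jn z x -> w <= jn z (cp x) -> w <= z) ->
  (forall x a b, x <= a -> cp x <= b ->
     exists m, jn m x = a /\ jn m (cp x) = b) ->
  is_boolean_lattice P.
Proof.
move=> joinP bt_le le_tp jnC central split_ex.
have jnl x y : x <= jn x y.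
  by have := lexx (jn x y); rewrite joinP => /andP[].
have jnr x y : y <= jn x y.
  by have := lexx (jn x y); rewrite joinP => /andP[].
have le_central x z w :
    jn w x <= jn z x -> jn w (cp x) <= jn z (cp x) -> w <= z.
  move=> h1 h2; apply: (central x).
    exact: le_trans (jnl _ _) h1.
  exact: le_trans (jnl _ _) h2.
(* In the coordinates given by [x] and [cp x], the element [x] is [(x, tp)] and [y] is
   [(y v x, y v cp x)]; their componentwise meet is [(x, y v cp x)]. *)
have mt_ex x y : {m | jn m x = x /\ jn m (cp x) = jn y (cp x)}.
  by apply: cid; apply: split_ex.
pose mt x y := sval (mt_ex x y).
have mtx x y : jn (mt x y) x = x by case: (svalP (mt_ex x y)).
have mtc x y : jn (mt x y) (cp x) = jn y (cp x) by case: (svalP (mt_ex x y)).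
have jn_mono x y z : x <= y -> jn x z <= jn y z.
  by move=> xy; rewrite joinP jnr (le_trans xy).
have meetP w x y : (w <= mt x y) = (w <= x) && (w <= y).
  apply/idP/andP => [wm|[wx wy]].
    split; first by rewrite (le_trans wm) // -{2}(mtx x y) jnl.
    rewrite (le_trans wm) //; apply: (le_central x).
      by rewrite mtx jnr.
    by rewrite mtc.
  apply: (le_central x); last by rewrite mtc jn_mono.
  by rewrite mtx joinP wx /=.
have mtl x y : mt x y <= x by have := lexx (mt x y); rewrite meetP => /andP[].
have mtr x y : mt x y <= y by have := lexx (mt x y); rewrite meetP => /andP[].
have mtC x y : mt x y = mt y x.
  by apply/le_anti; rewrite !meetP !mtl !mtr.
apply: (boolean_lattice_of_operations meetP joinP _ bt_le le_tp jnC).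
(* One inequality is formal. The other is checked on joins with [z] and [cp z]: both sides become
   [z] and [x v y v cp z]. *)
- move=> x y z; rewrite ![mt _ z]mtC; apply/le_anti/andP; split; last first.
    by rewrite meetP !joinP !mtl !(le_trans (mtr _ _)).
  apply: (le_central z); first by rewrite mtx jnr.
  rewrite mtc !joinP jnr andbT; apply/andP; split.
    by rewrite (le_trans (jnl x (cp z))) // -mtc jn_mono.
  by rewrite (le_trans (jnl y (cp z))) // -mtc jn_mono.
- move=> x; apply/le_anti; rewrite bt_le andbT.
  apply: (central x).
    exact: le_trans (mtl _ _) (jnr _ _).
  exact: le_trans (mtr _ _) (jnr _ _).
Qed.

(** * Products, pushouts and product projections *)

Section CategoryLemmas.
Variable C : category.
Implicit Types A B D X Y Z T : C.

Lemma binary_product A B :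
  has_finite_products C ->
  exists (X : C) (p : hom X A) (q : hom X B), is_product p q.
Proof.
move=> /(_ bool (fun b => if b then A else B))[X [pi pi_prod]].
exists X, (pi true), (pi false) => Y f g.
pose F b : hom Y (if b then A else B) :=
  if b as b0 return hom Y (if b0 then A else B) then f else g.
have [h [hF h_uniq]] := pi_prod Y F.
exists h; split=> [|k [kf kg]].
  by split; [exact: hF true | exact: hF false].
by apply: h_uniq => -[].
Qed.

Lemma terminal_object : has_finite_products C -> exists T, is_terminal T.
Proof.
move=> /(_ void (of_void C))[T [pi pi_prod]]; exists T => Y.
have [h [_ h_uniq]] := pi_prod Y (fun i => match i with end).
by exists h; split=> // k _; apply: h_uniq => -[].
Qed.

Lemma is_product_sym X A B (p : hom X A) (q : hom X B) :
  is_product p q -> is_product q p.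
Proof.
move=> pq Y f g; have [h [[hp hq] h_uniq]] := pq Y g f.
by exists h; split=> // k [kq kp]; apply: h_uniq.
Qed.

Lemma is_pushout_sym X A B Z (f : hom X A) (g : hom X B)
    (u : hom A Z) (v : hom B Z) :
  is_pushout f g u v -> is_pushout g f v u.
Proof.
case=> uv univ; split=> // W a b ab.
have [h [[hu hv] h_uniq]] := univ W b a (esym ab).
by exists h; split=> // k [kv ku]; apply: h_uniq.
Qed.

Lemma product_projectionP X A (p : hom X A) :
  product_projection p -> exists A' (p' : hom X A'), is_product p p'.
Proof.
by case=> A' [p' [|/is_product_sym]] pp'; exists A', p'.
Qed.

Lemma is_product_projl X A B (p : hom X A) (q : hom X B) :
  is_product p q -> product_projection p.
Proof. by move=> pq; exists B, q; left. Qed.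

Lemma is_product_projr X A B (p : hom X A) (q : hom X B) :
  is_product p q -> product_projection q.
Proof. by move=> pq; exists A, p; right. Qed.

Lemma is_product_eq X A B (p : hom X A) (q : hom X B) Y (h k : hom Y X) :
  is_product p q -> p ∘ h = p ∘ k -> q ∘ h = q ∘ k -> h = k.
Proof.
move=> pq hkp hkq; have [l [_ l_uniq]] := pq Y (p ∘ k) (q ∘ k).
by rewrite -(l_uniq h) // -(l_uniq k).
Qed.

Lemma terminal_eq T Y (h k : hom Y T) : is_terminal T -> h = k.
Proof. by move=> /(_ Y)[l [_ l_uniq]]; rewrite -(l_uniq h) // -(l_uniq k). Qed.

(** An object is its own product with a terminal object. This is the source of the trivial product
    projections: isomorphisms and maps to a terminal object. *)
Lemma iso_is_product X A T (m : hom X A) (n : hom A X) (t : hom X T) :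
  n ∘ m = idm X -> m ∘ n = idm A -> is_terminal T -> is_product m t.
Proof.
move=> nm mn T_term Y f g; exists (n ∘ f); split=> [|k [<- _]].
  by rewrite compA mn comp1m; split=> //; apply: terminal_eq.
by rewrite compA nm comp1m.
Qed.

Lemma is_product_iso X Y A B (p : hom X A) (q : hom X B)
    (k : hom Y X) (l : hom X Y) :
  l ∘ k = idm Y -> k ∘ l = idm X -> is_product p q ->
  is_product (p ∘ k) (q ∘ k).
Proof.
move=> lk kl pq Z f g; have [h [[hp hq] h_uniq]] := pq Z f g.
exists (l ∘ h); split=> [|i [ip iq]].
  by rewrite -!compA [k ∘ (l ∘ h)]compA kl comp1m.
by rewrite (h_uniq (k ∘ i)) ?compA ?lk ?comp1m.
Qed.

(* The complement of [f1 x f2] is the product of the complements. *)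
Lemma product_projection_prod X A1 A2 Y B1 B2 (p1 : hom X A1) (p2 : hom X A2)
    (q1 : hom Y B1) (q2 : hom Y B2)
    (f1 : hom A1 B1) (f : hom X Y) (f2 : hom A2 B2) :
  has_finite_products C ->
  is_product p1 p2 -> is_product q1 q2 ->
  product_projection f1 -> product_projection f2 ->
  f1 ∘ p1 = q1 ∘ f -> f2 ∘ p2 = q2 ∘ f -> product_projection f.
Proof.
move=> fp p12 q12 /product_projectionP[D1 [g1 fg1]].
move=> /product_projectionP[D2 [g2 fg2]] fE1 fE2.
have [D [d1 [d2 d12]]] := binary_product D1 D2 fp.
have [g [[gE1 gE2] _]] := d12 X (g1 ∘ p1) (g2 ∘ p2).
apply: (@is_product_projl _ _ _ f g) => Z u v.
have [a1 [[fa1 ga1] _]] := fg1 Z (q1 ∘ u) (d1 ∘ v).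
have [a2 [[fa2 ga2] _]] := fg2 Z (q2 ∘ u) (d2 ∘ v).
have [h [[ph1 ph2] _]] := p12 Z a1 a2.
have fh : f ∘ h = u.
  by apply: (is_product_eq q12); rewrite compA -?fE1 -?fE2 -compA ?ph1 ?ph2.
have gh : g ∘ h = v.
  by apply: (is_product_eq d12); rewrite compA ?gE1 ?gE2 -compA ?ph1 ?ph2.
exists h; split=> // k [fk gk]; apply: (is_product_eq p12).
  apply: (is_product_eq fg1); rewrite compA [RHS]compA.
    by rewrite fE1 -!compA fh fk.
  by rewrite -gE1 -!compA gh gk.
apply: (is_product_eq fg2); rewrite compA [RHS]compA.
  by rewrite fE2 -!compA fh fk.
by rewrite -gE2 -!compA gh gk.
Qed.

Lemma iso_product_projection X A (m : hom X A) (n : hom A X) :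
  has_finite_products C ->
  n ∘ m = idm X -> m ∘ n = idm A -> product_projection m.
Proof.
move=> /terminal_object[T T_term] nm mn; have [t _] := T_term X.
exact: is_product_projl (iso_is_product t nm mn T_term).
Qed.

(** If [A'] is the complementary factor of [p], then [u ∘ p] is the product of [u] and [A' -> 1],
    since [B] is [B * 1]; both factors are product projections. *)
Lemma product_projection_comp X A B (p : hom X A) (u : hom A B) :
  has_finite_products C ->
  product_projection p -> product_projection u -> product_projection (u ∘ p).
Proof.
move=> fp /product_projectionP[A' [p' pp']] u_proj.
have [T T_term] := terminal_object fp.
have [t _] := T_term A'; have [s _] := T_term B.
have idBs := iso_is_product s (comp1m (idm B)) (comp1m (idm B)) T_term.
have idA't := iso_is_product t (comp1m (idm A')) (comp1m (idm A')) T_term.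
apply: (product_projection_prod fp pp' idBs u_proj (is_product_projr idA't)).
  by rewrite comp1m.
exact: terminal_eq.
Qed.

End CategoryLemmas.

(** * Pushouts, products and complements read in [Proj X] *)

Section ProjOrder.
Variables (C : category) (X : C).
Hypothesis fp : has_finite_products C.
Implicit Types a b s : Proj X.

Definition cls (A : C) (f : hom X A) (f_proj : product_projection f) : Proj X :=
  proj_class (ProjOf f_proj).

Lemma cls_le A B (f : hom X A) (g : hom X B)
    (f_proj : product_projection f) (g_proj : product_projection g) :
  cls f_proj <= cls g_proj <-> exists h : hom A B, g = h ∘ f.
Proof. exact: le_proj_class. Qed.

Lemma cls_surj a :
  exists (A : C) (f : hom X A) (f_proj : product_projection f), a = cls f_proj.
Proof.
case E: (repr a) => [A f f_proj]; exists A, f, f_proj.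
by rewrite /cls -E /proj_class reprK.
Qed.

Lemma id_projection : product_projection (idm X).
Proof. exact: (iso_product_projection fp (comp1m _) (comp1m _)). Qed.

Lemma cls_id_le s : cls id_projection <= s.
Proof.
have [A [f [f_proj ->]]] := cls_surj s.
by apply/cls_le; exists f; rewrite compm1.
Qed.

Lemma terminal_projection T (t : hom X T) :
  is_terminal T -> product_projection t.
Proof.
move=> T_term.
exact: is_product_projr (iso_is_product t (comp1m _) (comp1m _) T_term).
Qed.

Lemma le_cls_terminal T (t : hom X T) (t_proj : product_projection t) s :
  is_terminal T -> s <= cls t_proj.
Proof.
move=> T_term; have [A [f [f_proj ->]]] := cls_surj s.
have [u _] := T_term A; apply/cls_le; exists u; exact: terminal_eq.
Qed.

Lemma cls_pushout_le A B P (f : hom X A) (g : hom X B) (u : hom A P)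
    (v : hom B P) (d : hom X P) (f_proj : product_projection f)
    (g_proj : product_projection g) (d_proj : product_projection d) s :
  is_pushout f g u v -> d = u ∘ f ->
  (cls d_proj <= s) = (cls f_proj <= s) && (cls g_proj <= s).
Proof.
have [D [k [k_proj ->]]] := cls_surj s.
case=> uv univ dE; apply/idP/andP => [/cls_le[h hE]|].
  split; apply/cls_le; first by exists (h ∘ u); rewrite hE dE compA.
  by exists (h ∘ v); rewrite hE dE uv compA.
case=> /cls_le[h hE] /cls_le[l lE]; apply/cls_le.
have [m [[mu mv] _]] := univ D h l (etrans (esym hE) lE).
by exists m; rewrite dE compA mu.
Qed.

Lemma le_cls_product Y B1 B2 (q1 : hom Y B1) (q2 : hom Y B2) (f : hom X Y)
    (g1 : hom X B1) (g2 : hom X B2) (f_proj : product_projection f)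
    (g1_proj : product_projection g1) (g2_proj : product_projection g2) s :
  is_product q1 q2 -> g1 = q1 ∘ f -> g2 = q2 ∘ f ->
  s <= cls g1_proj -> s <= cls g2_proj -> s <= cls f_proj.
Proof.
have [D [k [k_proj ->]]] := cls_surj s.
move=> q12 g1E g2E /cls_le[h1 h1E] /cls_le[h2 h2E]; apply/cls_le.
have [h [[qh1 qh2] _]] := q12 D h1 h2; exists h.
apply: (is_product_eq q12); rewrite compA ?qh1 ?qh2.
  by rewrite -g1E.
by rewrite -g2E.
Qed.

Lemma le_cls_complementary A1 A2 (p1 : hom X A1) (p2 : hom X A2)
    (p1_proj : product_projection p1) (p2_proj : product_projection p2) s t :
  is_product p1 p2 -> s <= cls p1_proj -> s <= cls p2_proj -> s <= t.
Proof.
move=> p12 s1 s2; apply: (le_trans _ (cls_id_le t)).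
by apply: (le_cls_product _ p12 _ _ s1 s2); rewrite compm1.
Qed.

Hypothesis X_codisj : codisjoint_products X.

Lemma cls_complementary_le A1 A2 (p1 : hom X A1) (p2 : hom X A2)
    (p1_proj : product_projection p1) (p2_proj : product_projection p2) s t :
  is_product p1 p2 -> cls p1_proj <= s -> cls p2_proj <= s -> t <= s.
Proof.
move=> p12 s1 s2; have [P [u1 [u2 [u12 P_term]]]] := X_codisj.2 _ _ _ _ p12.
have d_proj := terminal_projection (u1 ∘ p1) P_term.
apply: (le_trans (le_cls_terminal d_proj t P_term)).
by rewrite (cls_pushout_le p1_proj p2_proj d_proj s u12) // s1.
Qed.

(** The inequality provides [l : B -> P], and cancelling the epimorphisms [p] and [f] shows that [l]
    carries the legs [g, q] to [u, v]. Hence cocones extend along [l] through [P], uniquely because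
    [g ∘ p] is an epimorphism. *)
Lemma pushout_of_le A Y B P (p : hom X A) (f : hom X Y) (u : hom A P)
    (v : hom Y P) (g : hom A B) (q : hom Y B)
    (gp_proj : product_projection (g ∘ p))
    (up_proj : product_projection (u ∘ p)) :
  product_projection p -> product_projection f -> is_pushout p f u v ->
  g ∘ p = q ∘ f -> cls gp_proj <= cls up_proj -> is_pushout p f g q.
Proof.
move=> p_proj f_proj [uv univ] gq /cls_le[l lE].
have lg : l ∘ g = u by apply: (X_codisj.1 _ _ p_proj); rewrite -compA lE.
have lq : l ∘ q = v.
  by apply: (X_codisj.1 _ _ f_proj); rewrite -compA -gq -uv lE.
split=> // Z a b ab; have [h [[hu hv] _]] := univ Z a b ab.
exists (h ∘ l); split=> [|k [kg kq]]; first by rewrite -!compA lg lq.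
apply: (X_codisj.1 _ _ gp_proj).
by rewrite -compA -lE compA hu compA kg.
Qed.

Definition has_projection_pushouts : Prop :=
  forall (A B : C) (p : hom X A) (q : hom X B),
    product_projection p -> product_projection q ->
    exists (P : C) (u : hom A P) (v : hom B P),
      [/\ is_pushout p q u v, product_projection u & product_projection v].

(** * From a Boolean lattice to coextensivity *)

Section BooleanToCoextensive.
Hypotheses (pushouts : has_projection_pushouts)
  (boolP : is_boolean_lattice (Proj X)).

Variables (A1 A2 Y B1 B2 : C) (p1 : hom X A1) (p2 : hom X A2).
Variables (q1 : hom Y B1) (q2 : hom Y B2).
Variables (f1 : hom A1 B1) (f : hom X Y) (f2 : hom A2 B2).
Hypotheses (p12 : is_product p1 p2) (f1_proj : product_projection f1)
  (f_proj : product_projection f) (f2_proj : product_projection f2).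
Hypotheses (fE1 : f1 ∘ p1 = q1 ∘ f) (fE2 : f2 ∘ p2 = q2 ∘ f).

Let p1_proj := is_product_projl p12.
Let p2_proj := is_product_projr p12.
Let f1p1_proj := product_projection_comp fp p1_proj f1_proj.
Let f2p2_proj := product_projection_comp fp p2_proj f2_proj.

(** It suffices that [[f1 ∘ p1]] lies below the join of [[p1]] and [[f]]. By distributivity this is
    tested below [[p1]], where it is clear, and below [[p2]], where a lower bound of [[f1 ∘ p1]] is
    also below [[f2 ∘ p2]], hence below [[f]]. The other square follows by symmetry. *)
Lemma Mpushout_of_product :
  is_product q1 q2 -> is_Mpushout (@product_projection C) p1 f f1 q1.
Proof.
move=> q12; have [P [u [v [uv u_proj v_proj]]]] := pushouts p1_proj f_proj.
have up_proj := product_projection_comp fp p1_proj u_proj.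
have := cls_pushout_le p1_proj f_proj up_proj (cls up_proj) uv erefl.
rewrite lexx => /esym/andP[p1_le f_le].
split=> //; last exact: is_product_projl q12.
apply: (pushout_of_le (gp_proj := f1p1_proj) p1_proj f_proj uv fE1).
(* The join of [[p1]] and [[p2]] is the top, so [j] may be the element to be bounded itself. *)
apply: (@boolean_lattice_cover _ _ (cls p1_proj) (cls p2_proj)
         (cls f1p1_proj) (cls f1p1_proj) _ boolP).
- by move=> w; apply: cls_complementary_le p12.
- exact: lexx.
- by move=> w w_le _; exact: le_trans w_le p1_le.
- move=> w w_le wf1; apply: (le_trans _ f_le).
  apply: (le_cls_product _ q12 fE1 fE2 wf1).
  by apply: (le_trans w_le); apply/cls_le; exists f2.
Qed.

(** The product [W] of [B1] and [B2] receives [g], the product of [f1] and [f2]. Once [[g] = [f]],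
    the comparison [Y -> W] is invertible, as [f] and [g] are epimorphisms. *)
Lemma product_of_pushouts :
  is_pushout p1 f f1 q1 -> is_pushout p2 f f2 q2 -> is_product q1 q2.
Proof.
move=> po1 po2; have [W [w1 [w2 w12]]] := binary_product B1 B2 fp.
have [g [[gE1 gE2] _]] := w12 X (f1 ∘ p1) (f2 ∘ p2).
have g_proj : product_projection g.
  exact: (product_projection_prod fp p12 w12 f1_proj f2_proj (esym gE1)).
have [k [[kq1 kq2] _]] := w12 Y q1 q2.
have gE : g = k ∘ f.
  by apply: (is_product_eq w12); rewrite compA ?kq1 ?kq2 ?gE1 ?gE2.
(* Distribute [[g]] over [[f1 ∘ p1] = [p1] v [f]], then what lies below [[p1]] over [[f2 ∘ p2] =
   [p2] v [f]]. What is left is below both [[p1]] and [[p2]], hence below everything. *)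
have /cls_le[l lE] : cls g_proj <= cls f_proj.
  apply: (@boolean_lattice_cover _ _ (cls p1_proj) (cls f_proj)
           (cls f1p1_proj) (cls g_proj) _ boolP) => //.
  - move=> w; rewrite (cls_pushout_le p1_proj f_proj f1p1_proj w po1) //.
    by move=> -> ->.
  - by apply/cls_le; exists w1.
  move=> w w_p1 w_g.
  apply: (@boolean_lattice_cover _ _ (cls p2_proj) (cls f_proj)
           (cls f2p2_proj) w _ boolP) => //.
  - move=> t; rewrite (cls_pushout_le p2_proj f_proj f2p2_proj t po2) //.
    by move=> -> ->.
  - by apply: (le_trans w_g); apply/cls_le; exists w2.
  move=> t t_p2 t_w.
  exact: le_cls_complementary _ p12 (le_trans t_w w_p1) t_p2.
have kl : k ∘ l = idm W.
  by apply: (X_codisj.1 _ _ g_proj); rewrite -compA -lE -gE comp1m.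
have lk : l ∘ k = idm Y.
  by apply: (X_codisj.1 _ _ f_proj); rewrite -compA -gE -lE comp1m.
by rewrite -kq1 -kq2; apply: is_product_iso lk kl w12.
Qed.

End BooleanToCoextensive.

(** * From coextensivity to a Boolean lattice *)

Section CoextensiveToBoolean.
Hypothesis X_coext : projection_coextensive X.

(** Since [p] is an epimorphism, [B] with legs [idm B] and [h] is a pushout of [h ∘ p] and [p].
    Coextensivity gives a pushout whose legs are projections, and [h] is such a leg up to
    isomorphism. *)
Lemma projection_right_factor A B (p : hom X A) (h : hom A B) :
  product_projection p -> product_projection (h ∘ p) -> product_projection h.
Proof.
move=> p_proj hp_proj.
have [P [u [v [[uv univ] u_proj v_proj]]]] := X_coext.1 _ _ _ _ hp_proj p_proj.
have [m [[mu mv] _]] := univ B (idm B) h (comp1m (h ∘ p)).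
have um : u ∘ m = idm P.
  apply: (X_codisj.1 _ _ (product_projection_comp fp hp_proj u_proj)).
  by rewrite comp1m -compA [m ∘ _]compA mu comp1m.
rewrite -mv; apply: (product_projection_comp fp v_proj).
exact: iso_product_projection fp um mu.
Qed.

Lemma Proj_join_ex a b :
  exists c, forall s, (c <= s) = (a <= s) && (b <= s).
Proof.
have [A [p [p_proj ->]]] := cls_surj a.
have [B [q [q_proj ->]]] := cls_surj b.
have [P [u [v [uv u_proj v_proj]]]] := X_coext.1 _ _ _ _ p_proj q_proj.
exists (cls (product_projection_comp fp p_proj u_proj)) => s.
exact: cls_pushout_le uv erefl.
Qed.

(** A relation, because a complementary leg is only known to exist; [choice] later extracts an
    operation. *)
Definition complementary a b : Prop :=
  exists (A1 A2 : C) (p1 : hom X A1) (p2 : hom X A2)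
    (p1_proj : product_projection p1) (p2_proj : product_projection p2),
    [/\ is_product p1 p2, a = cls p1_proj & b = cls p2_proj].

Lemma complementary_ex a : exists b, complementary a b.
Proof.
have [A1 [p1 [p1_proj ->]]] := cls_surj a.
have [A2 [p2 p12]] := product_projectionP p1_proj.
exists (cls (is_product_projr p12)).
by exists A1, A2, p1, p2, p1_proj, (is_product_projr p12).
Qed.

Lemma coextensive_boolean : is_boolean_lattice (Proj X).
Proof.
have [jn joinP] : {jn : Proj X -> Proj X -> Proj X |
    forall a b s, (jn a b <= s) = (a <= s) && (b <= s)}.
  by exists (fun a => projT1 (choice (Proj_join_ex a))) => a;
    exact: projT2 (choice (Proj_join_ex a)).
have [cp cpP] := choice complementary_ex.
have jnE a b c : (forall s, (c <= s) = (a <= s) && (b <= s)) -> jn a b = c.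
  by move=> cP; apply/le_anti; rewrite joinP cP -cP -joinP !lexx.
have [T T_term] := terminal_object fp; have [t _] := T_term X.
have t_proj := terminal_projection t T_term.
apply: (@boolean_lattice_of_central _ _ jn cp (cls id_projection) (cls t_proj)).
- exact: joinP.
- exact: cls_id_le.
- by move=> s; apply: le_cls_terminal.
- move=> x; apply/le_anti; rewrite le_cls_terminal //=.
  have := lexx (jn x (cp x)); rewrite {1}joinP => /andP[].
  have [A1 [A2 [p1 [p2 [p1_proj [p2_proj [p12 -> ->]]]]]]] := cpP x.
  exact: cls_complementary_le p12.
(* The pushouts of [f] along [p1] and [p2] form a product row under [X], so [z] is the meet of its
   joins with [x] and its complement. *)
- move=> x z w.
  have [A1 [A2 [p1 [p2 [p1_proj [p2_proj [p12 -> ->]]]]]]] := cpP x.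
  have [Y [f [f_proj ->]]] := cls_surj z.
  have [P1 [u1 [v1 [uv1 u1_proj v1_proj]]]] := X_coext.1 _ _ _ _ f_proj p1_proj.
  have [P2 [u2 [v2 [uv2 u2_proj v2_proj]]]] := X_coext.1 _ _ _ _ f_proj p2_proj.
  have uf1_proj := product_projection_comp fp f_proj u1_proj.
  have uf2_proj := product_projection_comp fp f_proj u2_proj.
  rewrite (jnE _ _ (cls uf1_proj)); last first.
    by move=> s; apply: cls_pushout_le uv1 erefl.
  rewrite (jnE _ _ (cls uf2_proj)); last first.
    by move=> s; apply: cls_pushout_le uv2 erefl.
  suff u12 : is_product u1 u2 by apply: le_cls_product _ u12 _ _.
  apply/(X_coext.2 _ _ _ _ _ _ _ _ _ v1 f v2 p12) => //.
  + by rewrite uv1.1.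
  + by rewrite uv2.1.
  + by split; split=> //; apply: is_pushout_sym.
- move=> x a b.
  have [A1 [A2 [p1 [p2 [p1_proj [p2_proj [p12 -> ->]]]]]]] := cpP x.
  have [B1 [g1 [g1_proj ->]]] := cls_surj a.
  have [B2 [g2 [g2_proj ->]]] := cls_surj b.
  move=> /cls_le[h1 h1E] /cls_le[h2 h2E]; subst g1 g2.
  (* Coextensivity applies only to vertical maps that are projections, so the factors [h1] and [h2]
     must be shown to be such. *)
  have h1_proj := projection_right_factor p1_proj g1_proj.
  have h2_proj := projection_right_factor p2_proj g2_proj.
  have [Y [q1 [q2 q12]]] := binary_product B1 B2 fp.
  have [f [[fE1 fE2] _]] := q12 X (h1 ∘ p1) (h2 ∘ p2).
  have f_proj : product_projection f.
    exact: (product_projection_prod fp p12 q12 h1_proj h2_proj (esym fE1)).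
  (* The bottom row is a product by construction, so both squares are pushouts, and these compute
     the joins of [[f]] with [[p1]] and [[p2]]. *)
  have /(X_coext.2 _ _ _ _ _ _ _ _ _ h1 f h2 p12)
    [//|//|//|//|//|[po1 _ _] [po2 _ _]] := q12.
  exists (cls f_proj); split; apply: jnE => s; rewrite andbC.
    exact: cls_pushout_le po1 erefl.
  exact: cls_pushout_le po2 erefl.
Qed.

End CoextensiveToBoolean.

End ProjOrder.

Theorem theorem3p1 (C : category) (C_fin_prod : has_finite_products C)
    (X : obj C) (X_codisj : codisjoint_products X) :
  projection_coextensive X <->
  (forall (A B : obj C) (p : hom X A) (q : hom X B),
     product_projection p -> product_projection q ->
     exists (P : obj C) (u : hom A P) (v : hom B P),
       [/\ is_pushout p q u v, product_projection u & product_projection v]) /\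
  is_boolean_lattice (Proj X).
Proof.
split=> [X_coext|[pushouts boolP]].
  split; last exact: coextensive_boolean.
  by move=> A B p q; apply: X_coext.1.
split=> [Y A f p f_proj p_proj|]; first exact: pushouts.
move=> A1 A2 Y B1 B2 p1 p2 q1 q2 f1 f f2 p12 f1_proj f_proj f2_proj fE1 fE2.
split=> [q12|[[po1 _ _] [po2 _ _]]]; last first.
  exact: (product_of_pushouts C_fin_prod X_codisj boolP p12 f1_proj f_proj
            f2_proj fE1 fE2).
have sq := Mpushout_of_product C_fin_prod X_codisj pushouts boolP.
split; first exact: sq p12 f1_proj f_proj f2_proj fE1 fE2 q12.
(* The right-hand square is the left-hand one of the mirrored diagram. *)
exact: sq (is_product_sym p12) f2_proj f_proj f1_proj fE2 fE1
  (is_product_sym q12).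
Qed.
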